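(* Let $r\ge 2$ and $2\le \ell_1\le \cdots\le \ell_r$ be integers. Then, as $n\to\infty$, $$F\big(n,\mathcal L^{(r)}_{\ell_1,\dots,\ell_r}\big)\le (\ell_r-1)^{\frac{1}{\ell_1\cdots\ell_{r-1}}}\,n^{1-\frac{1}{\ell_1\cdots\ell_{r-1}}}+O\left(n^{\frac12+\frac{1}{2\ell_{r-1}}-\frac{1}{\ell_1\cdots\ell_{r-1}}}\right),$$ where the implied constant depends only on $r,\ell_1,\dots,\ell_r$.
   Context: For an abelian group $G$, a set $A\subset G$ is called $\mathcal L^{(r)}_{\ell_1,\dots,\ell_r}$-free if $A$ contains no sumset $L_1+\cdots+L_r=\{\lambda_1+\cdots+\lambda_r:\lambda_i\in L_i\}$ with $L_i\subset G$ and $|L_i|=\ell_i$ for $i=1,\dots,r$. (The sums need not be pairwise distinct.) $F\big(n,\mathcal L^{(r)}_{\ell_1,\dots,\ell_r}\big)$ denotes the largest size of an $\mathcal L^{(r)}_{\ell_1,\dots,\ell_r}$-free set of integers contained in $\{1,\dots,n\}$ (here $G=\mathbb Z$). *)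

(* Defs.v *)
From mathcomp Require Import all_boot all_order all_algebra finmap.
From mathcomp Require Import all_classical all_reals all_analysis.

Set Implicit Arguments.
Unset Strict Implicit.
Unset Printing Implicit Defensive.

Import Order.TTheory GRing.Theory Num.Theory.

Local Open Scope ring_scope.
Local Open Scope classical_set_scope.

Definition sumset (G : zmodType) (r : nat) (L : 'I_r -> {fset G}) : set G :=
  [set \sum_(i < r) x i | x in [set x : 'I_r -> G | forall i, x i \in L i]].

Definition sumset_free (G : zmodType) (r : nat) (ell : r.-tuple nat)
    (A : set G) : Prop :=
  ~ exists L : 'I_r -> {fset G},
      (forall i, #|` L i| = tnth ell i) /\ sumset L `<=` A.

Definition int_interval (n : nat) : {fset int} :=
  [fset k%:Z | k in iota 1 n]%fset.

(* When every entry of [ell] is positive the empty set is free, so the maximum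
   is attained; for other [ell] it may range over no set and is then 0. *)
Definition F (r : nat) (ell : r.-tuple nat) (n : nat) : nat :=
  \max_(A <- fpowerset (int_interval n) | `[< sumset_free ell [set` A] >])
    #|` A|.

(* Main.v *)
Require Import Defs.
From mathcomp Require Import all_boot all_order all_algebra finmap.
From mathcomp Require Import all_classical all_reals all_analysis.
From mathcomp Require Import zify ring lra.
Import Order.TTheory GRing.Theory Num.Theory.
Import numFieldNormedType.Exports.

Local Open Scope ring_scope.

(** The upper bound is a moving-window count, in the manner of the
    Erdos-Turan-Lindstrom bound for Sidon sets, iterated over the factors of
    the sumset.

    Write [l = l_1] and let [A] be free for [(l_1, ..., l_r)].  For an
    [l]-element set [D], the set of all [b] with [b + D] inside [A] contains no
    sumset of shape [(l_2, ..., l_r)] ([sumset_free_translates]), so by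
    induction it has at most some [B] elements.  Slide a window [U] over [A]:
    if [W] contains all positions at which the window meets [A] and
    [M = |W|], then the incidences between positions [m] in [W] and places [g]
    in [U], given by [m + g] in [A], number [|U| |A|], while any [l] places
    have at most [B] common positions.  The Kovari-Sos-Turan inequality
    [kovari_sos_turan] then gives
      [(|U| |A| - (l - 1) M)^l <= M^(l - 1) |U|^l B],
    that is, [|A| <= M^(1 - 1/l) B^(1/l) + l M / |U|].

    Start from [B <= l_r - 1] for a single factor.  Each further factor
    multiplies the exponent denominator by [l] and adds to the relative error
    only [l M^(1/P) / |U|], where [P] is the product of the lengths treated so
    far, [l] included; the largest power of [M] is that of the second factor,
    where [P = l_(r-1)].  This is
    [sumset_free_card_le]:
      [|A| <= M ((l_r - 1) / M)^(1/P) (1 + S M^(1/l_(r-1)) / |U|)],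
    with [S = l_1 + ... + l_(r-1)] and [P = l_1 ... l_(r-1)].

    For [A] in [{1, ..., n}] and a window of length [u] one has [M = n + u], a
    relative loss of [u / n].  It balances [n^(1/l_(r-1)) / u] when
    [u = n^b] with [b = 1/2 + 1/(2 l_(r-1))], and both are then of order
    [n^(b - 1)] ([window_estimate]); multiplied by the main term
    [n^(1 - 1/P)] this is the announced error [n^(b - 1/P)]. *)

(** * Counting common neighbours *)

(** The power mean inequality, by induction on the exponent; the step is
    Chebyshev's sum inequality for the similarly ordered families [y] and
    [y ^ k.+1], proved by adding the two orders of summation. *)
Lemma expn_sum_le {I : finType} (y : I -> nat) (k : nat) :
  ((\sum_i y i) ^ k.+1 <= #|I| ^ k * \sum_i y i ^ k.+1)%N.
Proof.
elim: k => [|k IHk].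
  by rewrite expn1 expn0 mul1n; under [leqRHS]eq_bigr do rewrite expn1.
have chebyshev :
    ((\sum_i y i) * \sum_j y j ^ k.+1 <= #|I| * \sum_i y i ^ k.+2)%N.
  rewrite -leq_double -!addnn big_distrlr /=.
  rewrite {2}exchange_big /= -big_split /=.
  have -> : (#|I| * \sum_i y i ^ k.+2 + #|I| * \sum_i y i ^ k.+2 =
      \sum_i \sum_j (y i ^ k.+2 + y j ^ k.+2))%N.
    under [RHS]eq_bigr do rewrite big_split /= sum_nat_const.
    by rewrite big_split /= sum_nat_const -big_distrr.
  apply: leq_sum => i _; rewrite -big_split /=; apply: leq_sum => j _.
  rewrite !(expnS _ k.+1).
  have := leq_exp2r (y i) (y j) (ltn0Sn k).
  by have := leq_exp2r (y j) (y i) (ltn0Sn k); nia.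
rewrite expnS (leq_trans (leq_mul (leqnn _) IHk)) // mulnCA [in leqRHS]expnSr.
by rewrite -mulnA leq_mul2l chebyshev orbT.
Qed.

(** Each of the [l] factors [a, a - 1, ..., a - (l - 1)] is at least the last
    one; when [a < l - 1] truncation makes the left-hand side vanish. *)
Lemma expn_subn_le_ffact (a l : nat) : ((a - l.-1) ^ l <= a ^_ l)%N.
Proof.
have [le_la|/ltnW lt_al] := leqP l.-1 a; last first.
  case: l lt_al => [|l] //= le_al.
  by rewrite (_ : a - l = 0)%N ?exp0n //; apply/eqP; rewrite subn_eq0.
rewrite ffact_prod -[X in (_ ^ X)%N]card_ord -prod_nat_const.
by apply: leq_prod => i _; have := ltn_ord i; lia.
Qed.

Lemma ffact_le_expn (a l : nat) : (a ^_ l <= a ^ l)%N.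
Proof.
rewrite ffact_prod -[X in (_ ^ X)%N]card_ord -prod_nat_const.
by apply: leq_prod => i _; apply: leq_subr.
Qed.

(** The bipartite graph [e] has no [K_(l, B + 1)] with the [l] vertices in [U].
    Counting pairs of a vertex [m] and an [l]-subset of its neighbourhood in
    two ways bounds the sum of the ['C(#|e m|, l)]; the power mean inequality
    plays the part of convexity. *)
Lemma kovari_sos_turan {W U : finType} (e : W -> {set U}) (l B : nat)
    (l_gt0 : (0 < l)%N)
    (eB : forall D : {set U}, #|D| = l -> (#|[set m | D \subset e m]| <= B)%N) :
  ((\sum_m #|e m| - l.-1 * #|W|) ^ l <= #|W| ^ l.-1 * (#|U| ^ l * B))%N.
Proof.
apply: (@leq_trans ((\sum_m (#|e m| - l.-1)) ^ l)).
  rewrite leq_exp2r // leq_subLR mulnC -sum_nat_const -big_split /=.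
  by apply: leq_sum => m _; rewrite -leq_subLR.
have -> : ((\sum_m (#|e m| - l.-1)) ^ l =
    (\sum_m (#|e m| - l.-1)) ^ l.-1.+1)%N by rewrite prednK.
apply: leq_trans (expn_sum_le _ _) _.
rewrite prednK // leq_mul2l; apply/orP; right.
apply: (@leq_trans (\sum_m 'C(#|e m|, l) * l`!)).
  by apply: leq_sum => m _; rewrite bin_ffact expn_subn_le_ffact.
rewrite -big_distrl /=.
have -> : (\sum_m 'C(#|e m|, l) =
    \sum_(D : {set U} | #|D| == l) #|[set m | D \subset e m]|)%N.
  under eq_bigr do rewrite -cards_draws -sum1dep_card.
  rewrite (exchange_big_dep (fun D : {set U} => #|D| == l)) /=; last first.
    by move=> m D _ /andP[].
  apply: eq_bigr => D Dl; rewrite -sum1dep_card.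
  by apply: eq_bigl => m; rewrite Dl andbT.
apply: (@leq_trans ('C(#|U|, l) * B * l`!)%N).
  rewrite leq_mul2r -[in 'C(_, _)]cardsT -cards_draws -sum_nat_const.
  apply/orP; right; rewrite [leqRHS](eq_bigl (fun D : {set U} => #|D| == l)).
    by apply: leq_sum => D /eqP/eB.
  by move=> D; rewrite inE finset.subsetT.
by rewrite mulnAC bin_ffact leq_mul2r ffact_le_expn orbT.
Qed.

(** * Translates of a set inside a free set *)

(** If [B] contained [L_2 + ... + L_r], then [A] would contain
    [D + L_2 + ... + L_r]. *)
Lemma sumset_free_translates {G : zmodType} {r : nat} (l : nat)
    (ell : r.-tuple nat) (A B D : {fset G})
    (freeA : sumset_free [tuple of l :: ell] [set` A]%classic)
    (Dl : #|` D| = l)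
    (BD : forall b d, b \in B -> d \in D -> b + d \in A) :
  sumset_free ell [set` B]%classic.
Proof.
move=> [L [Ls LB]]; apply: freeA.
exists (fun i => if unlift ord0 i is Some j then L j else D); split.
  move=> i; case: unliftP => [j|] ->; first by rewrite tnthS Ls.
  by rewrite tnth0.
move=> _ [x xL <-]; rewrite big_ord_recl addrC; apply: BD.
  apply: LB; exists (fun i => x (lift ord0 i)) => // i.
  by have := xL (lift ord0 i); rewrite liftK.
by have := xL ord0; rewrite unlift_none.
Qed.

Lemma sumset_free1_card {G : zmodType} (ell : 1.-tuple nat) (A : {fset G})
    (freeA : sumset_free ell [set` A]%classic) :
  (#|` A| < nth 0 ell 0)%N.
Proof.
rewrite ltnNge; apply/negP => le_lA; apply: freeA.
exists (fun=> [fset x in take (nth 0%N ell 0) (enum_fset A)]%fset); split.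
  move=> i; rewrite (ord1 i) (tnth_nth 0%N) card_fseq undup_id.
    by rewrite size_takel.
  exact/take_uniq/fset_uniq.
move=> _ [x xL <-]; rewrite big_ord1; have := xL ord0.
by rewrite inE => /mem_take.
Qed.

(** The left-hand side counts incidences by the place [g] in the window: a
    point [a] of [A] is seen at [g] from the position [a - g], which lies in
    [t + W]. *)
Lemma card_translate_incidence {G : zmodType} (I U W A : {fset G}) (t : G)
    (IUW : forall i g, i \in I -> g \in U -> i - g \in W)
    (AI : forall a, a \in A -> a - t \in I) :
  (#|` U| * #|` A| <=
    \sum_(m : W) #|[set g : U | (t + val m + val g)%R \in A]|)%N.
Proof.
rewrite (cardfE U) -sum_nat_const.
under [leqRHS]eq_bigr do rewrite -sum1dep_card.
rewrite (exchange_big_dep predT) //=; apply: leq_sum => g _.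
rewrite sum1dep_card cardfE.
pose f (a : A) : W := FSetSub (IUW _ _ (AI _ (fsvalP a)) (fsvalP g)).
have f_inj : injective f.
  by move=> a b /(congr1 val) /= /addIr /addIr /val_inj.
rewrite -cardsT -(finset.card_imset _ f_inj) subset_leq_card //.
apply/fintype.subsetP => _ /imsetP[a _ ->]; rewrite inE /=.
by rewrite -addrA subrK subrKC fsvalP.
Qed.

(** Taking [l]-th roots in [kovari_sos_turan] when [B] is within a factor
    [1 + e] of [X].  The target [Y] is characterized by the value of its [l]-th
    power, and [(1 + e)^(1/l)] is replaced by the larger [1 + e], so that no
    root appears. *)
Lemma le_of_expn_le {R : realType} (a B l u M : nat) (X Y e : R)
    (u_gt0 : (0 < u)%N) (l_gt0 : (0 < l)%N) (Y_ge0 : 0 <= Y) (e_ge0 : 0 <= e)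
    (aB : ((u * a - l.-1 * M) ^ l <= M ^ l.-1 * (u ^ l * B))%N)
    (BX : B%:R <= X * (1 + e)) (XY : M%:R ^+ l.-1 * X = Y ^+ l) :
  a%:R <= Y * (1 + e) + l%:R * M%:R / u%:R.
Proof.
have u0 : 0 < u%:R :> R by rewrite ltr0n.
have e1 : 0 < 1 + e by rewrite ltr_pwDl.
have main : (u * a - l.-1 * M)%N%:R <= u%:R * Y * (1 + e).
  rewrite -(ler_pXn2r l_gt0) ?nnegrE ?mulr_ge0 ?(ltW e1) //.
  apply: (@le_trans _ _ (M ^ l.-1 * (u ^ l * B))%N%:R).
    by rewrite -natrX ler_nat.
  rewrite !natrM !natrX !exprMn -XY mulrCA -!mulrA.
  apply: ler_wpM2l; first by rewrite exprn_ge0.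
  apply: ler_wpM2l; first by rewrite exprn_ge0.
  apply: (le_trans BX).
  apply: ler_wpM2l; last by apply: ler_eXnr => //; rewrite lerDl.
  by rewrite -(pmulr_lge0 _ e1) (le_trans _ BX).
rewrite -(ler_pM2l u0) mulrDr [X in _ + X]mulrC divfK ?gt_eqF//.
have : (u * a)%:R <= (u * a - l.-1 * M)%:R + (l * M)%:R :> R.
  by rewrite -natrD ler_nat; have := leq_pred l; nia.
rewrite !natrM; lra.
Qed.

(** * Iterating over the factors of the sumset *)

(** This says [M <= Y * M^(1/q)] for the main term [Y = M * (c / M)^(1/p)],
    which turns an additive error [l * M / u] into a relative one. *)
Lemma powR_div_mul_ge1 {R : realType} (c M : R) (p q : nat)
    (c_ge1 : 1 <= c) (M_ge1 : 1 <= M) (q_gt0 : (0 < q)%N) (qp : (q <= p)%N) :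
  1 <= (c / M) `^ p%:R^-1 * M `^ q%:R^-1.
Proof.
have M_gt0 : 0 < M := lt_le_trans ltr01 M_ge1.
have cM_ge0 : 0 <= c / M.
  by rewrite divr_ge0 ?(ltW M_gt0) ?(le_trans ler01).
apply: (@le_trans _ _ ((c / M) `^ p%:R^-1 * M `^ p%:R^-1)).
  rewrite -powRM ?(ltW M_gt0)// divfK ?gt_eqF//.
  by rewrite -[X in X <= _](powRr0 c) ler_powR ?invr_ge0.
rewrite ler_wpM2l ?powR_ge0// ler_powR// lef_pV2 ?posrE ?ltr0n ?ler_nat//.
exact: leq_trans qp.
Qed.

(** Induction on the number of factors, removing the first one.  The set [A]
    lies in a translate of [I] because passing to the set of all [b] with
    [b + D] inside [A] only keeps it within a translate.  For a single factor
    the sum is empty and the error term vanishes, whatever the entry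
    [nth 0 ell r.-1] is; afterwards this entry never changes, being the last
    one but one, and it divides the product of the lengths. *)
Lemma sumset_free_card_le {R : realType} {G : zmodType} (I U W : {fset G})
    {r : nat} (ell : r.+1.-tuple nat) (A : {fset G}) (t : G)
    (U_gt0 : (0 < #|` U|)%N) (W_gt0 : (0 < #|` W|)%N)
    (IUW : forall i g, i \in I -> g \in U -> i - g \in W)
    (ell_gt0 : all (ltn 0) ell) (ell_last : (1 < nth 0 ell r)%N)
    (AI : forall a, a \in A -> a - t \in I)
    (freeA : sumset_free ell [set` A]%classic) :
  #|` A|%:R <= #|` W|%:R *
    (((nth 0%N ell r)%:R - 1) / #|` W|%:R) `^
      (\prod_(0 <= i < r) nth 0 ell i)%N%:R^-1 *
    (1 + (\sum_(0 <= i < r) nth 0 ell i)%N%:R *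
      #|` W|%:R `^ (nth 0%N ell r.-1)%:R^-1 / #|` U|%:R) :> R.
Proof.
set M : R := #|` W|%:R; have M_ge1 : 1 <= M by rewrite ler1n.
have M_gt0 : 0 < M := lt_le_trans ltr01 M_ge1.
elim: r ell A t ell_gt0 ell_last AI freeA => [|r IHr] ell A t ell_gt0 ell_last.
  move=> AI freeA; rewrite !big_geq // invr1 powRr1; last first.
    by rewrite divr_ge0 ?subr_ge0 ?ler1n ?(ltW M_gt0)// ltnW.
  rewrite !mul0r addr0 mulr1 mulrC divfK ?gt_eqF// lerBrDr natr1 ler_nat.
  exact: sumset_free1_card.
case/tupleP: ell ell_gt0 ell_last => l ell /= /andP[l_gt0 ell_gt0] ell_last.
move=> AI freeA.
set c : R := _ - 1; set q := nth 0%N (l :: ell) r.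
have c_ge1 : 1 <= c by rewrite lerBrDr (_ : 1 + 1 = 2%:R) ?ler_nat.
rewrite [X in X%:R^-1]big_nat_recl //= [X in X%:R * _ `^ _]big_nat_recl //=.
set P := (\prod_(0 <= i < r) nth 0 ell i)%N.
set S := (\sum_(0 <= i < r) nth 0 ell i)%N.
have P_gt0 : (0 < P)%N.
  rewrite /P big_mkord; apply: prodn_gt0 => i.
  by apply: (all_nthP 0%N ell_gt0); rewrite size_tuple ltnW // ltnS.
have q_gt0 : (0 < q)%N.
  by apply: (@all_nthP _ _ (l :: ell) 0%N); rewrite /= ?l_gt0 // size_tuple.
have qP : (q <= l * P)%N.
  rewrite dvdn_leq ?muln_gt0 ?l_gt0 // /q.
  have -> : (l * P = \prod_(0 <= i < r.+1) nth 0 (l :: ell) i)%N.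
    by rewrite big_nat_recl.
  by rewrite big_nat_recr //= dvdn_mull.
set X := M * (c / M) `^ P%:R^-1; set Y := M * (c / M) `^ (l * P)%:R^-1.
have cM_ge0 : 0 <= c / M.
  by rewrite divr_ge0 ?(ltW M_gt0) ?(le_trans ler01).
have Y_ge0 : 0 <= Y by rewrite mulr_ge0 ?powR_ge0 // ltW.
set e := S%:R * M `^ q%:R^-1 / #|` U|%:R.
have e_ge0 : 0 <= e by rewrite divr_ge0 ?mulr_ge0 ?powR_ge0.
have X_ge0 : 0 <= X * (1 + e).
  by rewrite mulr_ge0 ?addr_ge0 // mulr_ge0 ?powR_ge0 // ltW.
have XY : M ^+ l.-1 * X = Y ^+ l.
  rewrite /X /Y exprMn mulrA -exprSr prednK //; congr (_ * _).
  rewrite -powR_mulrn ?powR_ge0 // -powRrM natrM invfM mulrAC mulVf ?mul1r //.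
  by rewrite pnatr_eq0 -lt0n.
have step : #|` A|%:R <= Y * (1 + e) + l%:R * M / #|` U|%:R.
  apply: (@le_of_expn_le _ _ (Num.trunc (X * (1 + e))) _ _ _ X) => //;
    last by rewrite truncn_le.
  (* The bound supplied by the induction hypothesis is real; its integer part
     serves as the number of common neighbours. *)
  have := card_translate_incidence _ _ _ _ _ IUW AI.
  set E := (\sum_m _)%N => le_AE.
  apply: (@leq_trans ((E - l.-1 * #|` W|) ^ l)%N).
    by rewrite leq_exp2r // leq_sub2r.
  rewrite !cardfE; apply: kovari_sos_turan => // D Dl.
  set Z := [set m | _].
  pose B := [fset (t + val m)%R | m in Z]%fset.
  have -> : #|Z| = #|` B|.
    rewrite card_imfset; last by move=> m n /addrI /val_inj.
    by rewrite cardE.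
  rewrite truncn_ge_nat //.
  have [d0 d0D] : exists d0, d0 \in D by apply/set0Pn; rewrite -card_gt0 Dl.
  have BD b d : b \in B -> d \in D -> b + val d \in A.
    move=> /imfsetP[m /= mZ ->] dD.
    by move: mZ; rewrite inE => /fintype.subsetP/(_ _ dD); rewrite inE.
  have -> : e = S%:R * M `^ (nth 0%N ell r.-1)%:R^-1 / #|` U|%:R.
    (* The two error terms have the same exponent, except for [r = 0], where
       both are 0. *)
    have [r0|r_gt0] := posnP r.
      by rewrite /e /S big_geq ?r0 // !mul0r.
    by rewrite /e /q; have -> k : (0 < k)%N -> nth 0%N (l :: ell) k =
      nth 0%N ell k.-1 by case: k.
  apply: (IHr ell B (t - val d0)) => //.
    by move=> b bB; rewrite opprB addrA; apply/AI/BD.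
  apply: (sumset_free_translates l ell A B [fset val d | d in D]%fset) => //.
    by rewrite card_imfset -?cardE //; apply: val_inj.
  by move=> b d bB /imfsetP[d' /= d'D ->]; apply: BD.
apply: (le_trans step); rewrite !mulrDr !mulr1 -addrA lerD2l.
rewrite natrD !mulrDl mulrDr addrC lerD //.
rewrite mulrA ler_wpM2r ?invr_ge0 // mulrCA ler_wpM2l //.
by rewrite /Y -mulrA ler_peMr ?powR_div_mul_ge1 // ltW.
Qed.

(** * The optimal window in an interval of integers *)

(** With [N = n], [b = 1/2 + 1/(2q)] and [h = N^(b - 1) <= 1], the window
    length satisfies [N h / 2 <= u <= N h].  Hence the main term grows by a
    factor at most [1 + u / N <= 1 + h], and, since [N^(1/q) = N^b h], the
    relative error is at most [4 S h]; finally
    [(1 + h) (1 + 4 S h) <= 1 + (1 + 8 S) h]. *)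
Lemma window_estimate {R : realType} (c S : R) (n u q P : nat)
    (c_ge0 : 0 <= c) (S_ge0 : 0 <= S) (n_gt0 : (0 < n)%N) (u_gt0 : (0 < u)%N)
    (q_gt0 : (0 < q)%N)
    (le_un : u%:R <= n%:R `^ (2^-1 + (2 * q%:R)^-1) :> R)
    (le_nu : n%:R `^ (2^-1 + (2 * q%:R)^-1) <= 2 * u%:R :> R) :
  (n + u)%N%:R * (c / (n + u)%N%:R) `^ P%:R^-1 *
      (1 + S * (n + u)%N%:R `^ q%:R^-1 / u%:R) <=
    c `^ P%:R^-1 * n%:R `^ (1 - P%:R^-1) +
    (1 + 8 * S) * c `^ P%:R^-1 * n%:R `^ (2^-1 + (2 * q%:R)^-1 - P%:R^-1).
Proof.
rewrite natrD; set N : R := n%:R; set v : R := u%:R in le_un le_nu *.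
set b := 2^-1 + (2 * q%:R)^-1 in le_un le_nu *; set p : R := P%:R^-1.
have N_ge1 : 1 <= N by rewrite ler1n.
have N_gt0 : 0 < N := lt_le_trans ltr01 N_ge1.
have N_neq0 : N != 0 by rewrite gt_eqF.
have v_gt0 : 0 < v by rewrite ltr0n.
have M_gt0 : 0 < N + v by rewrite addr_gt0.
have q1 : q%:R^-1 <= 1 :> R by rewrite invf_le1 ?ltr0n ?ler1n.
have p_ge0 : 0 <= p by rewrite invr_ge0.
have bE : b = 2^-1 + 2^-1 * q%:R^-1 by rewrite /b invfM.
set h := N `^ (b - 1).
have h_ge0 : 0 <= h by apply: powR_ge0.
have h_le1 : h <= 1.
  rewrite -[leRHS](powRr0 N) ler_powR //; lra.
have NbE : N `^ b = N * h.
  by rewrite -[in RHS](powRr1 (ltW N_gt0)) -powRD ?N_neq0 ?implybT // subrKC.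
have Nq : N `^ q%:R^-1 = N `^ b * h.
  rewrite -powRD ?N_neq0 ?implybT //; congr (_ `^ _); lra.
have Np : N `^ (b - p) = N `^ (1 - p) * h.
  rewrite -powRD ?N_neq0 ?implybT //; congr (_ `^ _); lra.
have le_v : v <= N * h by rewrite -NbE.
have err : S * (N + v) `^ q%:R^-1 / v <= 4 * S * h.
  rewrite ler_pdivrMr // mulrAC [4 * S]mulrC -!mulrA ler_wpM2l //.
  (* [N + v <= 2 N], and [2 `^ q%:R^-1 <= 2]. *)
  apply: (@le_trans _ _ ((2 * N) `^ q%:R^-1)).
    rewrite ge0_ler_powR ?nnegrE ?invr_ge0 ?mulr_ge0 ?(ltW M_gt0) //.
    by nra.
  rewrite powRM ?(ltW N_gt0) // Nq.
  have -> : 4 * (v * h) = 2 * ((2 * v) * h) by ring.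
  apply: ler_pM; rewrite ?mulr_ge0 ?powR_ge0 //.
    by rewrite -[leRHS](powRr1 (ler0n R 2)) ler_powR // ler1n.
  by rewrite ler_wpM2r.
have main : (N + v) * (c / (N + v)) `^ p <= (1 + h) * (c `^ p * N `^ (1 - p)).
  have -> : (1 + h) * (c `^ p * N `^ (1 - p)) = (N + N * h) * (c / N) `^ p.
    rewrite powRM ?invr_ge0 ?(ltW N_gt0) // -powR_inv1 ?(ltW N_gt0) // -powRrM.
    rewrite powRD ?N_neq0 ?implybT // powRr1 ?(ltW N_gt0) // mulN1r; ring.
  apply: ler_pM; rewrite ?powR_ge0 ?(ltW M_gt0) ?lerD2l //.
  rewrite ge0_ler_powR ?nnegrE ?divr_ge0 ?(ltW M_gt0) ?(ltW N_gt0) //.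
  by rewrite ler_wpM2l // lef_pV2 ?posrE // lerDl ltW.
apply: (@le_trans _ _ ((1 + h) * (c `^ p * N `^ (1 - p)) * (1 + 4 * S * h))).
  apply: ler_pM => //.
  - by rewrite mulr_ge0 ?powR_ge0 ?(ltW M_gt0).
  - rewrite addr_ge0 //.
    by rewrite divr_ge0 ?mulr_ge0 ?powR_ge0 ?(ltW v_gt0).
  - by rewrite lerD2l.
rewrite Np; set Y := c `^ p * N `^ (1 - p).
have Y_ge0 : 0 <= Y by rewrite mulr_ge0 ?powR_ge0.
have -> : (1 + 8 * S) * c `^ p * (N `^ (1 - p) * h) = Y * ((1 + 8 * S) * h).
  by rewrite /Y; ring.
rewrite -{2}[Y]mulr1 -mulrDr mulrAC mulrC ler_wpM2l //.
have : S * h * h <= S * h by rewrite ler_piMr ?mulr_ge0.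
nra.
Qed.

Lemma mem_int_interval (n : nat) (k : int) :
  (k \in int_interval n) = (1 <= k <= n%:Z).
Proof.
apply/imfsetP/idP => /= [[j]|/andP[k_ge1 k_le]].
  by rewrite mem_iota => j_n ->; lia.
by exists `|k|%N; rewrite ?mem_iota; lia.
Qed.

Lemma card_int_interval (n : nat) : #|` int_interval n| = n.
Proof.
rewrite card_imfset /=; last by move=> i j [].
by rewrite undup_id ?iota_uniq // size_iota.
Qed.

Lemma int_interval_sub (n u : nat) (i g : int) :
  i \in int_interval n -> g \in int_interval u ->
  i - g \in [fset (k - u%:Z)%R | k in int_interval (n + u)]%fset.
Proof.
move=> i_n g_u; apply/imfsetP; exists (i - g + u%:Z); last by rewrite addrK.
by move: i_n g_u; rewrite /= !mem_int_interval; lia.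
Qed.

Local Open Scope classical_set_scope.
Local Open Scope ring_scope.

Theorem theorem1 (R : realType) (r : nat) (ell : r.-tuple nat)
    (r_ge2 : (2 <= r)%N)
    (ell_ge2 : forall i : 'I_r, (2 <= tnth ell i)%N)
    (ell_mono : forall i j : 'I_r, (i <= j)%N -> (tnth ell i <= tnth ell j)%N) :
  (* entries are numbered from 0: these are l_r, l_(r-1) and l_1 ... l_(r-1) *)
  let lr : nat := nth 0%N ell r.-1 in
  let lr1 : nat := nth 0%N ell r.-2 in
  let P : nat := (\prod_(0 <= i < r.-1) nth 0%N ell i)%N in
  exists2 E : nat -> R,
    E =O_\oo (fun n : nat => n%:R `^ (2^-1 + (2 * lr1%:R)^-1 - P%:R^-1)) &
    forall n : nat,
      (F ell n)%:R <=
        (lr%:R - 1) `^ P%:R^-1 * n%:R `^ (1 - P%:R^-1) + E n.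
Proof.
move=> lr lr1 P; case: r => [//|r] in ell r_ge2 ell_ge2 ell_mono lr lr1 P *.
have nth_ge2 i : (i < r.+1)%N -> (2 <= nth 0%N ell i)%N.
  by move=> ir; have := ell_ge2 (Ordinal ir); rewrite (tnth_nth 0%N).
have lr_ge2 : (2 <= lr)%N by apply: nth_ge2.
have lr1_gt0 : (0 < lr1)%N.
  by apply/ltnW/nth_ge2; rewrite /= ltnS leq_pred.
have ell_gt0 : all (ltn 0) ell.
  by apply/(all_nthP 0%N) => i; rewrite size_tuple => /nth_ge2/ltnW.
pose S : R := (\sum_(0 <= i < r) nth 0%N ell i)%N%:R.
pose b : R := 2^-1 + (2 * lr1%:R)^-1.
have lr_sub1 : 0 <= lr%:R - 1 :> R by rewrite subr_ge0 ler1n ltnW.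
pose C := (1 + 8 * S) * (lr%:R - 1) `^ P%:R^-1.
have C_ge0 : 0 <= C by rewrite mulr_ge0 ?powR_ge0 ?addr_ge0 ?mulr_ge0.
exists (fun n => C * n%:R `^ (b - P%:R^-1)).
  apply/eqO_exP; exists (C + 1); first by rewrite ltr_wpDl.
  apply: nearW => n; rewrite normrM ger0_norm // ler_wpM2r //.
  by rewrite lerDl.
have bound_ge0 (k : nat) : 0 <= (lr%:R - 1) `^ P%:R^-1 *
    k%:R `^ (1 - P%:R^-1) + C * k%:R `^ (b - P%:R^-1).
  by apply: addr_ge0; apply: mulr_ge0 => //; apply: powR_ge0.
move=> n; rewrite -truncn_ge_nat //; apply/bigmax_leqP_seq => A.
rewrite fpowersetE => AI /asboolP freeA.
case: n AI => [|n] AI.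
  by have := fsubset_leq_card AI; rewrite card_int_interval leqn0 => /eqP ->.
rewrite truncn_ge_nat //.
set m := n.+1; set u := Num.trunc (m%:R `^ b : R).
have mb_ge1 : 1 <= m%:R `^ b.
  by rewrite -[X in X <= _](powRr0 m%:R) ler_powR ?ler1n // addr_ge0.
have u_gt0 : (0 < u)%N by rewrite truncn_gt0.
have /andP[le_u lt_u] := truncn_itv (powR_ge0 (m%:R : R) b).
have le_2u : m%:R `^ b <= 2 * u%:R :> R.
  apply: (le_trans (ltW lt_u)); rewrite -/u -natrM ler_nat; lia.
set W := [fset (k - u%:Z)%R | k in int_interval (m + u)]%fset.
have W_card : #|` W| = (m + u)%N.
  by rewrite card_imfset /= ?card_int_interval //; apply: addIr.
have := @sumset_free_card_le R _ (int_interval m) (int_interval u) W r ell A 0.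
rewrite W_card !card_int_interval => /(_ u_gt0 isT (int_interval_sub m u)).
move=> /(_ ell_gt0 lr_ge2) H; apply: le_trans; first apply: H => //.
  by move=> a aA; rewrite subr0; apply: (fsubsetP AI).
exact: window_estimate.
Qed.
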